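(* Let $r$ be odd, and let $M$ be the rank-$r$ paving matroid coming from a Steiner system $S(r-1,q,n)$. Suppose that $M$ is Hamiltonian, i.e. has at least one Hamiltonian circuit. Let $HC(M)$ be the hypergraph whose vertices are the elements of $M$ and whose hyperedges are the Hamiltonian circuits of $M$. Then $hc(HC(M))=q+2$.
   Context: A Steiner system $S(t,k,n)$ is an $n$-element set of points together with a family of $k$-element subsets (blocks) such that every $t$-element subset of points lies in exactly one block. The rank-$r$ paving matroid coming from a Steiner system $S(r-1,q,n)$ is the matroid on the $n$ points whose hyperplanes (flats of rank $r-1$) are exactly the blocks, so every hyperplane has $q$ elements; equivalently, its bases are the $r$-element sets of points not contained in any block. A matroid of rank $r$ is paving if every circuit has at least $r$ elements. A Hamiltonian circuit of a rank-$r$ matroid is a circuit of size $r+1$. For an integer $t\ge 1$, a $t$-colouring of a hypergraph $H=(V,E)$ is a surjective function $\phi:V\to\{1,\dots,t\}$ (all colours must be used). A $t$-colouring $\phi$ is heterochromatic if there is a hyperedge $e\in E$ whose vertices receive pairwise distinct colours under $\phi$ (a totally multicoloured hyperedge). The heterochromatic number $hc(H)$ is the minimum $t\ge 1$ such that every $t$-colouring of $H$ is heterochromatic. *)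

(* Defs.v *)
From mathcomp Require Import all_boot.

Set Implicit Arguments.
Unset Strict Implicit.
Unset Printing Implicit Defensive.

Record matroid (T : finType) := Matroid {
  indep : {set {set T}};
  indep0 : set0 \in indep;
  indep_subset : forall I J : {set T},
    J \in indep -> I \subset J -> I \in indep;
  indep_augment : forall I J : {set T},
    I \in indep -> J \in indep -> #|I| < #|J| ->
    exists2 x, x \in J :\: I & x |: I \in indep }.

Section MatroidTheory.
Variables (T : finType) (M : matroid T).

Definition rank_of (A : {set T}) : nat :=
  \max_(I in indep M | I \subset A) #|I|.

Definition matroid_rank : nat := rank_of [set: T].

Definition flat (F : {set T}) : bool :=
  [forall x, (x \notin F) ==> (rank_of F < rank_of (x |: F))].

Definition hyperplanes : {set {set T}} :=
  [set F | flat F & (rank_of F).+1 == matroid_rank].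

Definition circuit (C : {set T}) : bool :=
  minset (fun A => A \notin indep M) C.

Definition paving : Prop :=
  forall C : {set T}, circuit C -> matroid_rank <= #|C|.

Definition hamiltonian_circuit (C : {set T}) : bool :=
  circuit C && (#|C| == matroid_rank.+1).

Definition hamiltonian : Prop := exists C : {set T}, hamiltonian_circuit C.

End MatroidTheory.

Definition steiner_system (t k n : nat) (T : finType) (B : {set {set T}}) :
    Prop :=
  [/\ #|T| = n,
      forall b, b \in B -> #|b| = k
    & forall A : {set T}, #|A| = t -> exists! b, b \in B /\ A \subset b].

(* A matroid is determined by its hyperplanes, so the last condition leaves
   at most one M for given blocks B. *)
Definition paving_matroid_of_steiner (r q n : nat) (T : finType)
    (B : {set {set T}}) (M : matroid T) : Prop :=
  [/\ steiner_system r.-1 q n B, matroid_rank M = r, paving M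
    & hyperplanes M = B].

(* A hypergraph on the vertex type V is given by its set of hyperedges. *)
Definition hypergraph (V : finType) := {set {set V}}.

Definition HC (T : finType) (M : matroid T) : hypergraph T :=
  [set C | hamiltonian_circuit M C].

Section HeterochromaticNumber.
Variables (V : finType) (H : hypergraph V).

(* The colours 1, ..., t are represented by 'I_t. *)
Definition colouring (t : nat) (phi : {ffun V -> 'I_t}) : bool :=
  [forall c, exists v, phi v == c].

Definition heterochromatic (t : nat) (phi : {ffun V -> 'I_t}) : bool :=
  [exists e in H, dinjectiveb phi (mem e)].

Definition all_heterochromatic (t : nat) : bool :=
  [forall phi : {ffun V -> 'I_t}, colouring phi ==> heterochromatic phi].

(* There is no t-colouring at all when t > #|V|, so the minimum exists. *)
Lemma hc_exists : exists t, (0 < t) && all_heterochromatic t.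
Proof.
exists #|V|.+1; apply/forallP => phi; apply/implyP => /forallP phi_onto.
have : #|'I_(#|V|.+1)| <= #|codom phi|.
  apply: subset_leq_card; apply/subsetP => c _.
  by have /existsP[v /eqP <-] := phi_onto c; apply: codom_f.
by rewrite card_ord => /leq_trans/(_ (leq_image_card phi V)); rewrite ltnn.
Qed.

Definition hc : nat := ex_minn hc_exists.

End HeterochromaticNumber.

(* Main.v *)
Require Import Defs.
From mathcomp Require Import all_boot.
From mathcomp Require Import zify.

(** Write [r] for the rank.  By [hamiltonian_circuit_steinerP], the Hamiltonian
    circuits are the [r.+1]-sets in general position, i.e. those meeting every
    block in fewer than [r] points.

    Lower bound ([few_colours_not_heterochromatic]): for [t <= q.+1], spend
    [t.-1] colours on [t.-1] points of one block [b] and give the last colour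
    to all other points.  A Hamiltonian circuit has at least two points outside
    [b], and they share that last colour.

    Upper bound: a colouring with [q.+2] colours has a transversal [S] of size
    [q.+2 >= r.+1], and no block contains more than [#|S| - 2] points of it.
    Such a set always contains [r.+1] points in general position
    ([general_position_subset]).  To see this, delete points from [S] one at a
    time until [#|S| = r.+1], keeping the bound [#|S| - 2]; at the end it says
    exactly that [S] is in general position.  Suppose that [r.+2 <= #|S|] and
    that no point can be deleted.  Then each [x] in [S] is missed by a block
    holding all but two points of [S].  Distinct blocks share at most [r - 2]
    points, so these missed pairs partition [S].  Hence [#|S|] is even and, [r]
    being odd, [r.+3 <= #|S|]; but then two such blocks would share [r.-1]
    points, so there is only one pair, which cannot cover [S]. *)

Set Implicit Arguments.
Unset Strict Implicit.
Unset Printing Implicit Defensive.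

(** * Points in general position *)

(** For even [r] the missed pairs can partition a set of [r.+2] points.  The
    affine cube with its fourteen planes of four points ([r = 4], eight points)
    has no five points in general position at all. *)
Lemma general_position_subset (T : finType) (B : {set {set T}}) (r : nat)
    (S : {set T}) :
  odd r ->
  {in B &, forall b b', r.-1 <= #|b :&: b'| -> b = b'} ->
  r.+1 <= #|S| ->
  {in B, forall b, #|b :&: S| + 2 <= #|S|} ->
  exists C : {set T},
    [/\ C \subset S, #|C| = r.+1 & {in B, forall b, #|C :&: b| < r}].
Proof.
move=> r_odd B_sep; have [m] := ubnP #|S|.
elim: m S => // m IHm S le_m le_rS B_small.
have [S_min|S_big] := eqVneq #|S| r.+1.
  exists S; split=> // b /B_small; rewrite S_min setIC; lia.
have [/existsP[x /andP[xS /forall_inP x_ok]]|stuck] :=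
  boolP [exists x, (x \in S) &&
    [forall b in B, #|b :&: (S :\ x)| + 2 <= #|S :\ x|]].
  have cS : #|S| = (#|S :\ x|).+1 by rewrite (cardsD1 x) xS.
  have [||C [CS cC CB]] := IHm (S :\ x) _ _ x_ok; try lia.
  by exists C; split=> //; apply: subset_trans CS (subD1set S x).
pose large b := (b \in B) && (#|b :&: S| + 2 == #|S|).
pose P := [set S :\: b | b in large].
have cSD b : #|S| = #|b :&: S| + #|S :\: b| by rewrite setIC cardsID.
have missed x : x \in S -> exists2 b, large b & x \notin b.
  move=> xS; have := forallP (etrans (esym (negb_exists _)) stuck) x.
  rewrite xS negb_forall_in => /exists_inP[b bB].
  have cS : #|S| = (#|S :\ x|).+1 by rewrite (cardsD1 x) xS.
  have := B_small b bB; rewrite setIDA cS => h1 h2.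
  have := cardsD1 x (b :&: S); rewrite inE xS andbT => h3.
  exists b; first by rewrite /large bB /=; lia.
  by case: (x \in b) h3 => //=; lia.
have largeB b b' : large b -> large b' ->
    #|(S :\: b) :|: (S :\: b')| + r.-1 <= #|S| -> b = b'.
  move=> lb lb' h; apply: B_sep; [by case/andP: lb | by case/andP: lb' |].
  have := cSD (b :&: b'); rewrite setDIr.
  have := subset_leq_card (subsetIl (b :&: b') S); lia.
have pairP b : large b -> #|S :\: b| = 2.
  by case/andP=> _ /eqP; have := cSD b; lia.
have r_gt0 : 0 < r by case: (r) r_odd.
have partP : partition P S.
  apply/and3P; split.
  - apply/eqP/setP=> x; apply/bigcupP/idP=> [[_ /imsetP[b _ ->]]|xS].
      by case/setDP.
    have [b lb xb] := missed x xS; exists (S :\: b); first exact: imset_f.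
    by rewrite inE xb.
  - apply/trivIsetP=> _ _ /imsetP[b lb ->] /imsetP[b' lb' ->].
    apply: contraR => /pred0Pn[x /andP[xb xb']].
    apply/eqP; congr (S :\: _); apply: largeB => //.
    (* Overlapping pairs leave at least [#|S| - 3 >= r.-1] common points. *)
    have := cardsUI (S :\: b) (S :\: b'); rewrite !pairP //.
    have : 0 < #|(S :\: b) :&: (S :\: b')|.
      by apply/card_gt0P; exists x; rewrite inE; apply/andP.
    lia.
  - apply/imsetP=> -[b lb /esym/eqP]; rewrite -cards_eq0.
    by rewrite pairP.
have S_even : ~~ odd #|S|.
  have /(card_uniform_partition)/(_ partP) -> :
      {in P, forall A : {set T}, #|A| = 2}.
    by move=> _ /imsetP[b lb ->]; apply: pairP.
  by rewrite oddM andbF.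
have le_r3S : r.+3 <= #|S|.
  have : #|S| != r.+2 by apply: contraNneq S_even => ->; rewrite /= negbK.
  lia.
have /card_gt0P[x xS] : 0 < #|S| by lia.
have [b lb xb] := missed x xS.
have /subset_leq_card : S \subset S :\: b.
  apply/subsetP=> y yS; have [b' lb' yb'] := missed y yS.
  (* Any two pairs leave at least [#|S| - 4 >= r.-1] common points. *)
  rewrite inE yS andbT (largeB _ _ lb lb') //.
  have := cardsUI (S :\: b) (S :\: b'); rewrite !pairP //; lia.
rewrite pairP //; lia.
Qed.

(** * Hamiltonian circuits of the matroid of a Steiner system *)

Section Rank.
Variables (T : finType) (M : matroid T).

Lemma indep_rank (I A : {set T}) :
  I \in indep M -> I \subset A -> #|I| <= rank_of M A.
Proof.
move=> iI IA; rewrite /rank_of (bigD1 I) ?leq_maxl //.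
by rewrite iI.
Qed.

Lemma rank_witness (A : {set T}) :
  exists I : {set T}, [/\ I \in indep M, I \subset A & #|I| = rank_of M A].
Proof.
have [|I /andP[iI IA] e] :=
    @eq_bigmax_cond _ (fun I => (I \in indep M) && (I \subset A))
      (fun I : {set T} => #|I|).
  by apply/card_gt0P; exists set0; rewrite unfold_in /= indep0 sub0set.
by exists I.
Qed.

Lemma paving_indep (A : {set T}) :
  paving M -> #|A| < matroid_rank M -> A \in indep M.
Proof.
move=> pav cA; apply: contraLR cA => dA.
have [C cC CA] := minset_exists (P := fun A => A \notin indep M) dA.
by rewrite -leqNgt; apply: leq_trans (pav C cC) (subset_leq_card CA).
Qed.

(** If [A] spans the flat [F] and [x] lies outside [F], then a larger
    independent subset of [x |: F] augments [A], and only by [x]. *)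
Lemma indep_add_flat (F A : {set T}) (x : T) :
  flat M F -> A \in indep M -> A \subset F -> #|A| = rank_of M F ->
  x \notin F -> x |: A \in indep M.
Proof.
move=> /forallP/(_ x)/implyP flF iA AF cA xF.
have [J [iJ JF cJ]] := rank_witness (x |: F).
have [|y /setDP[yJ yA] iyA] := indep_augment iA iJ.
  by rewrite cA cJ flF.
have /setU1P[<- //|yF] := subsetP JF y yJ.
have := @indep_rank (y |: A) F iyA; rewrite subUset sub1set yF AF.
by rewrite cardsU1 yA cA ltnn => /(_ isT).
Qed.

End Rank.

Lemma subset_of_card (T : finType) (A : {set T}) (m : nat) :
  m <= #|A| -> exists2 A' : {set T}, A' \subset A & #|A'| = m.
Proof.
case/card_geqP=> s [us <- sA]; exists [set x in s].
  by apply/subsetP=> x; rewrite inE; apply: sA.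
by rewrite cardsE; apply/card_uniqP.
Qed.

Section SteinerMatroid.
Variables (r q n : nat) (T : finType) (B : {set {set T}}) (M : matroid T).
Hypothesis r_gt0 : 0 < r.
Hypothesis HM : paving_matroid_of_steiner r q n B M.

Lemma block_size (b : {set T}) : b \in B -> #|b| = q.
Proof. by case: HM => -[_ h _] _ _ _; apply: h. Qed.

Lemma block_rank (b : {set T}) : b \in B -> flat M b /\ rank_of M b = r.-1.
Proof.
by case: HM => _ rM _ <-; rewrite inE rM => /andP[-> /eqP <-].
Qed.

Lemma block_unique : {in B &, forall b b', r.-1 <= #|b :&: b'| -> b = b'}.
Proof.
case: HM => -[_ _ st] _ _ _ b b' bB bB' /subset_of_card[A].
rewrite subsetI => /andP[Ab Ab'] cA.
by have [b0 [_ u]] := st A cA; rewrite -(u b) // -(u b').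
Qed.

Lemma block_exists : exists2 b, b \in B & r.-1 <= q.
Proof.
case: HM => -[_ _ st] rM _ _.
have [I [_ _ cI]] := rank_witness M [set: T].
have [|A _ cA] := @subset_of_card _ I r.-1.
  by rewrite cI -/(matroid_rank M) rM leq_pred.
have [b [[bB Ab] _]] := st A cA.
by exists b => //; rewrite -cA -(block_size bB) subset_leq_card.
Qed.

(** The block through [r.-1] points of [A] is a flat spanned by them, so the
    remaining point lies in it: otherwise [A] would be independent. *)
Lemma dependent_sub_block (A : {set T}) :
  #|A| = r -> A \notin indep M -> exists2 b, b \in B & A \subset b.
Proof.
case: (HM) => -[_ _ st] rM pav _ cA dA.
have /card_gt0P[x xA] : 0 < #|A| by rewrite cA.
have cAx : #|A :\ x| = r.-1 by have := cardsD1 x A; rewrite xA cA => ->.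
have [b [[bB Ab] _]] := st _ cAx; have [flb rkb] := block_rank bB.
exists b => //; apply: contraNT dA => Anb.
rewrite -(setD1K xA); apply: (indep_add_flat flb) => //.
- by apply: paving_indep => //; rewrite cAx rM; lia.
- by rewrite cAx rkb.
by apply: contra Anb => xb; rewrite -(setD1K xA) subUset sub1set xb.
Qed.

(** A Hamiltonian circuit with [r] points in a block would have there an
    independent set, being a proper subset, of size larger than the rank
    [r.-1] of the block.  Conversely, a dependent proper subset of a set in
    general position would extend to a dependent [r]-set, hence to [r] points
    on one block. *)
Lemma hamiltonian_circuit_steinerP (C : {set T}) :
  reflect (#|C| = r.+1 /\ {in B, forall b, #|C :&: b| < r})
          (hamiltonian_circuit M C).
Proof.
case: (HM) => _ rM pav _; rewrite /hamiltonian_circuit rM.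
apply: (iffP andP) => [[/minsetP[_ minC] /eqP cC] | [cC gpC]].
  split=> // b bB; rewrite ltnNge; apply/negP=> /subset_of_card[A].
  rewrite subsetI => /andP[AC Ab] cA.
  have iA : A \in indep M.
    apply/negPn/negP=> /minC/(_ AC) eAC.
    by move: cC; rewrite -eAC cA; lia.
  by have := indep_rank iA Ab; rewrite (block_rank bB).2 cA; lia.
split; last by rewrite cC.
apply/minsetP; split=> [|A dA AC].
  by apply/negP=> iC; have := indep_rank iC (subsetT C);
  rewrite -/(matroid_rank M) rM cC ltnn.
apply/eqP; apply: contraNT dA => neAC.
have /properP[_ [x xC xA]] : A \proper C by rewrite properEneq neAC.
have sA : A \subset C :\ x by rewrite subsetD1 AC.
apply: indep_subset sA.
have cCx : #|C :\ x| = r by have := cardsD1 x C; rewrite xC cC => -[].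
apply/negPn/negP=> /(dependent_sub_block cCx)[b bB sb].
have := gpC b bB; rewrite ltnNge -{1}cCx subset_leq_card //.
by rewrite subsetI subD1set.
Qed.

(** * The two bounds on the number of colours *)

(** The extremal colouring gives the first [t.-1] points of an enumeration of a
    block the colours [1], ..., [t.-1] and every other point the colour [0];
    [index] sends the points off the block to [q], hence to the colour [0]. *)
Lemma few_colours_not_heterochromatic (t : nat) :
  hamiltonian M -> 0 < t <= q.+1 -> ~~ all_heterochromatic (HC M) t.
Proof.
case=> C0 hC0; case: t => // k /= le_kq.
have [b bB _] := block_exists; have cb := block_size bB.
pose i x := index x (enum b).
pose phi : {ffun T -> 'I_k.+1} :=
  [ffun x => if i x < k then inord (i x).+1 else ord0].
have phi_out x : x \notin b -> phi x = ord0.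
  move=> xb; rewrite ffunE ltnNge /i memNindex ?mem_enum //.
  by rewrite -cardE cb -ltnS le_kq.
have outside C : hamiltonian_circuit M C -> 1 < #|C :\: b|.
  case/hamiltonian_circuit_steinerP=> cC /(_ b bB).
  by have := cardsID b C; rewrite cC; lia.
apply/forallPn; exists phi; rewrite negb_imply; apply/andP; split.
  apply/forallP=> c; apply/existsP.
  case: (posnP c) => [c0 | c_gt0].
    have /card_gt0P[x /setDP[_ xb]] := ltnW (outside _ hC0).
    by exists x; rewrite phi_out //; apply/eqP/val_inj; rewrite /= c0.
  have ltck : c.-1 < k by have := ltn_ord c; lia.
  have ltcb : c.-1 < size (enum b) by rewrite -cardE cb; lia.
  have /card_gt0P[x0 _] := ltnW (outside _ hC0).
  exists (nth x0 (enum b) c.-1); rewrite ffunE /i index_uniq ?enum_uniq // ltck.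
  by rewrite prednK // inord_val.
apply/exists_inP=> -[C]; rewrite inE => /outside/card_gt1P[x [y [xC yC nxy]]].
case/setDP: xC => xC xb; case/setDP: yC => yC yb /dinjectiveP injC.
by move/eqP: nxy; apply; apply: injC => //; rewrite !phi_out.
Qed.

Lemma many_colours_heterochromatic : odd r -> all_heterochromatic (HC M) q.+2.
Proof.
move=> r_odd; apply/forallP=> phi; apply/implyP=> /forallP phi_onto.
have phiP c : {x | phi x = c}.
  by apply: sig_eqW; have /existsP[x /eqP ?] := phi_onto c; exists x.
(* [S] is a transversal of the colour classes. *)
pose s c := sval (phiP c); have sK : cancel s phi by move=> c; exact: (svalP (phiP c)).
pose S := [set s c | c in 'I_q.+2].
have cS : #|S| = q.+2 by rewrite card_imset ?card_ord //; apply: can_inj sK.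
have phi_inj : {in S &, injective phi}.
  by move=> _ _ /imsetP[c _ ->] /imsetP[d _ ->]; rewrite !sK => ->.
have [_ _ le_rq] := block_exists.
have [||C [CS cC gpC]] := general_position_subset (S := S) r_odd block_unique.
- by rewrite cS; lia.
- move=> b bB; rewrite cS -(block_size bB) addn2 !ltnS.
  exact: subset_leq_card (subsetIl _ _).
apply/exists_inP; exists C.
  by rewrite inE; apply/hamiltonian_circuit_steinerP.
by apply/dinjectiveP; apply: sub_in2 phi_inj; apply/subsetP.
Qed.

End SteinerMatroid.

Theorem theorem4p7 (r q n : nat) (T : finType) (B : {set {set T}})
    (M : matroid T) :
  odd r ->
  paving_matroid_of_steiner r q n B M ->
  hamiltonian M ->
  hc (HC M) = q + 2.
Proof.
move=> r_odd HM hamM; have r_gt0 : 0 < r by case: (r) r_odd.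
rewrite /hc addn2; case: ex_minnP => t /andP[t_gt0 t_het] t_min.
apply/eqP; rewrite eqn_leq t_min ?(many_colours_heterochromatic r_gt0 HM) //=.
rewrite ltnNge; apply: contraL t_het => le_tq.
by apply: (few_colours_not_heterochromatic r_gt0 HM hamM); rewrite t_gt0.
Qed.
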